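(* Let $N$ be a finite set of players with $|N|\ge 3$, and assume that for every $i\in N$, $\mathcal{S}_i\subseteq 2^{E_i}$ is a non-matroid set system. Then $(\mathcal{S}_i)_{i\in N}$ does not have the strong uniqueness property.
   Context: Atomic splittable congestion games. There are a finite set $E$ of resources, a finite set $N$ of players, and for each player $i$ a weight $d_i\ge0$ and a collection of allowable subsets $\mathcal{S}_i\subseteq 2^E$. A strategy of player $i$ is a vector in $P_i=\{\vec x_i\in\mathbb{R}_{\ge0}^{|\mathcal{S}_i|} : \sum_{S\in\mathcal{S}_i}x_S=d_i\}$. It induces loads $x_{i,e}=\sum_{S\in\mathcal{S}_i: e\in S}x_S$, and the total load on $e$ is $x_e=\sum_{i\in N}x_{i,e}$. There are player-specific cost functions $c_{i,e}:\mathbb{R}_{\ge0}\to\mathbb{R}_{\ge0}$, which are non-negative, strictly increasing, differentiable and convex. The cost of player $i$ is $\pi_i(\vec x)=\sum_{e\in E}c_{i,e}(x_e)x_{i,e}$; a Nash equilibrium is a strategy profile from which no player can reduce her cost by a unilateral deviation. Two equilibria $\vec x,\vec y$ are different if $x_{i,e}\ne y_{i,e}$ for some player $i$ and resource $e$; equilibria are unique if there are no two different equilibria. Non-matroids. A non-empty set system $\mathcal{S}_i\subseteq 2^{E_i}$, where $E_i=\bigcup_{S\in\mathcal{S}_i}S$ is finite, is called a non-matroid if $\mathcal{S}_i$ is an anti-chain (no member is a proper subset of another member) and $(E_i,\{X\subseteq S : S\in\mathcal{S}_i\})$ (the family of all subsets of members of $\mathcal{S}_i$ as independent sets) is not a matroid.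 Strong uniqueness property. Let $(\mathcal{S}_i)_{i\in N}$ be a family of set systems with $E_i=\bigcup_{S\in\mathcal{S}_i}S$. An embedding into a finite set $E$ is a family $\tau=(\tau_i)_{i\in N}$ of injective maps $\tau_i:E_i\to E$; it induces the isomorphic strategy spaces $\phi_{\tau_i}(\mathcal{S}_i)=\{\tau_i(S): S\in\mathcal{S}_i\}\subseteq 2^E$, where $\tau_i(S)=\{\tau_i(e):e\in S\}$. The family $(\mathcal{S}_i)_{i\in N}$ has the strong uniqueness property if for every finite set $E$ and every embedding $\tau$ into $E$, every atomic splittable congestion game on $E$ with allowable subsets $(\phi_{\tau_i}(\mathcal{S}_i))_{i\in N}$ (i.e. for all weights $d_i\ge0$ and all admissible cost functions) has unique Nash equilibria. *)

(* Defs.v *)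
From HB Require Import structures.
From mathcomp Require Import all_boot all_order all_algebra.

Set Implicit Arguments.
Unset Strict Implicit.
Unset Printing Implicit Defensive.

(* The finite-set notions come before the import of the classical sets, which
   would shadow the notations of finset. *)

Section Matroid.
Variable T : finType.
Implicit Types (G : {set T}) (I F : {set {set T}}).

Definition is_matroid G I : Prop :=
  [/\ forall X, X \in I -> X \subset G,
      set0 \in I,
      forall X Y : {set T}, Y \in I -> X \subset Y -> X \in I
    & forall X Y, X \in I -> Y \in I -> #|X| < #|Y| ->
        exists2 y, y \in Y :\: X & y |: X \in I].

Definition antichain F : Prop :=
  forall A B, A \in F -> B \in F -> ~~ (A \proper B).

Definition subsets_of_members F : {set {set T}} :=
  [set X : {set T} | [exists A in F, X \subset A]].

(* The union of the members, which may be smaller than the type T. *)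
Definition ground_set F : {set T} := cover F.

Definition non_matroid F : Prop :=
  [/\ F != set0, antichain F
    & ~ is_matroid (ground_set F) (subsets_of_members F)].

Definition embedded_set (E : finType) F
    (tau : {e : T | e \in ground_set F} -> E) (A : {set T}) : {set E} :=
  [set tau e | e : {e : T | e \in ground_set F} & val e \in A].

Definition embedded_system (E : finType) F
    (tau : {e : T | e \in ground_set F} -> E) : {set {set E}} :=
  [set embedded_set tau A | A in F].

End Matroid.

From mathcomp Require Import all_classical all_reals all_analysis.

Import Order.TTheory GRing.Theory Num.Theory.
Import numFieldNormedType.Exports.

Local Open Scope classical_set_scope.
Local Open Scope ring_scope.

(* Functions on the nonnegative reals are represented by functions on R, of
   which only the values on [0, +oo[ are constrained or used. In particular the
   derivative at 0 is the one-sided one. *)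
Definition differentiable_nonneg (R : realType) (f : R -> R) : Prop :=
  forall x : R, 0 <= x ->
    cvg ((fun y => (f y - f x) / (y - x)) @ within [set y | 0 <= y] x^').

Definition admissible_cost (R : realType) (f : R -> R) : Prop :=
  [/\ forall x : R, 0 <= x -> 0 <= f x,
      forall x y : R, 0 <= x -> x < y -> f x < f y,
      differentiable_nonneg f
    & convex_function (E := R^o) [set x : R^o | 0 <= x] f].

Section Game.
Variables (R : realType) (N E : finType).
Variables (F : N -> {set {set E}}) (d : N -> R) (c : N -> E -> R -> R).

(* In a profile [x], only the values [x i A] with [A \in F i] matter. *)
Implicit Type x : N -> {set E} -> R.

Definition strategy (i : N) (xi : {set E} -> R) : Prop :=
  (forall A, A \in F i -> 0 <= xi A) /\ \sum_(A in F i) xi A = d i.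

Definition load x (i : N) (e : E) : R := \sum_(A in F i | e \in A) x i A.

Definition total_load x (e : E) : R := \sum_i load x i e.

Definition player_cost x (i : N) : R :=
  \sum_e c i e (total_load x e) * load x i e.

Definition nash_equilibrium x : Prop :=
  (forall i, strategy i (x i)) /\
  forall i yi, strategy i yi ->
    player_cost x i <= player_cost [eta x with i |-> yi] i.

Definition unique_equilibria : Prop :=
  forall x y, nash_equilibrium x -> nash_equilibrium y ->
    forall i e, load x i e = load y i e.

End Game.

Definition strong_uniqueness (R : realType) (N : finType) (T : N -> finType)
    (S : forall i, {set {set T i}}) : Prop :=
  forall (E : finType) (tau : forall i, {e : T i | e \in ground_set (S i)} -> E),
    (forall i, injective (tau i)) ->
  forall (d : N -> R) (c : N -> E -> R -> R),
    (forall i, 0 <= d i) -> (forall i e, admissible_cost (c i e)) ->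
    unique_equilibria (fun i => embedded_system (tau i)) d c.

(* Main.v *)
(* When basis exchange fails, the system has members X and Y, an element a of
   X \ Y and elements b <> c of Y \ X such that every member inside X u Y
   contains a or both b and c.  Let s be a permutation of the players such that
   i, s i and s (s i) are distinct.  Identify the elements a, b, c of player i
   with shared resources r i, r (s i), r (s (s i)), keep all other elements
   private, and make those outside X u Y expensive and the others nearly free.
   With unit weights, player i essentially chooses between {r i} and
   {r (s i), r (s (s i))}.  If everybody takes the first option each r k has
   load 1, if everybody takes the second each has load 2.  With cost 7 t^2 for
   i on r i and 10 + t on r (s i) and r (s (s i)), both profiles are strict
   equilibria: the comparisons of marginal costs are 21 < 11 + 11 and
   13 + 13 < 28.  The private costs cannot vanish, so the actual strategy of a
   player is a minimiser of her own cost over the simplex, which exists by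
   compactness; strictness forces its loads on the shared resources. *)

Require Import Defs.
From HB Require Import structures.
From mathcomp Require Import all_boot all_order all_algebra.

Set Implicit Arguments.
Unset Strict Implicit.
Unset Printing Implicit Defensive.

(** * Basis exchange and its failure in non-matroids *)

Section NonMatroid.
Variable T : finType.
Implicit Types (F : {set {set T}}) (A B X Y Z : {set T}).

Definition basis_exchange F : Prop :=
  forall A B x, A \in F -> B \in F -> x \in A :\: B ->
    exists2 y, y \in B :\: A & y |: (A :\ x) \in F.

(** Each exchange brings [A] closer to [B] without changing its size, and once [A :\: B] is empty
    the antichain property forces [A = B]. *)
Lemma basis_exchange_card F A B : antichain F -> basis_exchange F ->
  A \in F -> B \in F -> #|A| = #|B|.
Proof.
move=> acF exF; have [n] := ubnP #|A :\: B|.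
elim: n A => // n IHn A leABn AF BF.
have [/eqP AB0 | [x xAB]] := set_0Vmem (A :\: B).
  rewrite setD_eq0 in AB0; apply/eq_card/setP/eqP.
  by rewrite eqEproper AB0 acF.
have [y yBA A'F] := exF A B x AF BF xAB.
have [yB yA] : y \in B /\ y \notin A by move: yBA; rewrite inE => /andP[].
have [xA xB] : x \in A /\ x \notin B by move: xAB; rewrite inE => /andP[].
have yAx : y \notin A :\ x by rewrite !inE (negPf yA) andbF.
rewrite -(IHn (y |: A :\ x)) //; first by rewrite cardsU1 yAx (cardsD1 x A) xA.
rewrite (leq_trans _ (leABn : #|_| <= n)) // proper_card //; apply/properP; split.
  apply/subsetP=> z; rewrite !inE => /andP[zB] /orP[/eqP zy | /andP[_ ->]].
    by rewrite zy yB in zB.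
  by rewrite zB.
by exists x => //; rewrite !inE eqxx (negPf xB) /= orbF; apply: contraNneq xB => ->.
Qed.

(** For augmentation, take [A] above [X], and [B] above [Y] with [B :\: (Y :|: A)] as small as
    possible. If no element of [Y :\: X] can be added to [X], exchanges give [B :\: A \subset Y] and
    [A :\: B \subset X]; as [A] and [B] have equal size, this yields [#|Y| <= #|X|]. *)
Lemma basis_exchange_matroid F : F != set0 -> antichain F -> basis_exchange F ->
  is_matroid (ground_set F) (subsets_of_members F).
Proof.
move=> F0 acF exF; split.
- move=> X; rewrite inE => /existsP[A /andP[AF XA]].
  exact: subset_trans XA (bigcup_sup A AF).
- by rewrite inE; have [A AF] := set0Pn _ F0; apply/existsP; exists A; rewrite AF sub0set.
- move=> X Y; rewrite !inE => /existsP[A /andP[AF YA]] XY.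
  by apply/existsP; exists A; rewrite AF (subset_trans XY).
move=> X Y; rewrite !inE => /existsP[A /andP[AF XA]] /existsP[B0 B0P] ltXY.
have [B /andP[BF YB] minB] :=
  @arg_minnP _ B0 [pred B | (B \in F) && (Y \subset B)] (fun B => #|B :\: (Y :|: A)|) B0P.
suff [y yYX yXF] : exists2 y, y \in Y :\: X & [exists A' in F, y |: X \subset A'].
  by exists y => //; rewrite inE.
have [/exists_inP [y yYX yXF]|/exists_inPn noext] :=
  boolP [exists y in Y :\: X, [exists A' in F, y |: X \subset A']].
  by exists y.
have noA y A' : y \in Y -> A' \in F -> X \subset A' -> y \in A' -> y \in X.
  move=> yY A'F XA' yA'; apply: contraT => yX.
  have := noext y; rewrite !inE yX yY => /(_ isT) /exists_inP [].
  by exists A' => //; rewrite subUset sub1set yA'.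
have YA y : y \in Y -> y \in A -> y \in X by move=> yY; apply: (noA y A).
(* Otherwise exchanging [y] for an element of [A] contradicts the choice of [B]. *)
have BY y : y \in B -> y \notin A -> y \in Y.
  move=> yB yA; apply: contraT => yY.
  have yBA : y \in B :\: A by rewrite inE yA.
  have [z zAB B'F] := exF B A y BF AF yBA.
  have [zA zB] : z \in A /\ z \notin B by move: zAB; rewrite inE => /andP[].
  have YB' : Y \subset z |: B :\ y.
    apply/subsetP=> w wY; rewrite !inE (subsetP YB) // andbT orbC.
    by rewrite (_ : w != y) //; apply: contraNneq yY => <-.
  have := minB (z |: B :\ y); rewrite !inE B'F YB' => /(_ isT).
  rewrite leqNgt => /negP []; apply: proper_card; apply/properP; split.
    apply/subsetP=> w; rewrite !inE negb_or -!andbA => /and3P[wY wA].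
    case/orP=> [/eqP wz | /andP[_ wB]]; first by rewrite wz zA in wA.
    by rewrite wY wA wB.
  exists y; rewrite !inE ?eqxx ?(negPf yY) ?(negPf yA) ?yB //= orbF.
  by apply: contraNneq yA => ->.
(* Otherwise trading [y] for some [z] of [B] gives a member that contains [X] and [z]; by [BY], [z]
   is in [Y], so [z] would extend [X]. *)
have AX y : y \in A -> y \notin B -> y \in X.
  move=> yA yB; apply: contraT => yX.
  have yAB : y \in A :\: B by rewrite inE yB.
  have [z zBA A'F] := exF A B y AF BF yAB.
  have [zB zA] : z \in B /\ z \notin A by move: zBA; rewrite inE => /andP[].
  have XA' : X \subset z |: A :\ y.
    apply/subsetP=> w wX; rewrite !inE (subsetP XA) // andbT orbC.
    by rewrite (_ : w != y) //; apply: contraNneq yX => <-.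
  have zX := noA z _ (BY z zB zA) A'F XA' (setU11 _ _).
  by rewrite (subsetP XA) in zA.
have cAB := basis_exchange_card acF exF AF BF.
have: #|A :\: B| = #|B :\: A|.
  by apply/eqP; rewrite -(eqn_add2l #|A :&: B|) cardsID setIC cardsID cAB.
have/subset_leq_card leAB : A :\: B \subset X :\: Y.
  apply/subsetP=> y; rewrite !inE => /andP[yB yA]; rewrite AX // andbT.
  by apply: contra yB; apply/subsetP.
have/subset_leq_card leYX : Y :\: X \subset B :\: A.
  apply/subsetP=> y; rewrite !inE => /andP[yX yY]; rewrite (subsetP YB) // andbT.
  by apply: contra yX; apply: YA.
move=> eqAB; rewrite eqAB in leAB; have := leq_trans leYX leAB.
rewrite -(leq_add2l #|X :&: Y|) cardsID {1}setIC cardsID.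
by rewrite leqNgt ltXY.
Qed.

Definition non_matroid_triple F X Y a b c : Prop :=
  [/\ X \in F, Y \in F, a \in X :\: Y, [/\ b \in Y :\: X, c \in Y :\: X & b != c]
    & forall Z, Z \in F -> Z \subset X :|: Y -> (a \in Z) || (b \in Z) && (c \in Z)].

(* If the exchange of x fails for X, Y, take a member Y' of X u Y avoiding x with
   Y' \ X as small as possible.  If Y' \ X has two elements b, c, the triple is
   x, b, c.  If Y' \ X = {b}, then Y' is a proper subset of X - x + b, and the
   roles of X and Y' are exchanged. *)
Lemma non_matroid_has_triple F : non_matroid F ->
  exists X Y a b c, non_matroid_triple F X Y a b c.
Proof.
case=> F0 acF nmF.
have [X [Y [x [XF YF xXY noy]]]] : exists X Y x,
    [/\ X \in F, Y \in F, x \in X :\: Y & forall y, y \in Y :\: X -> y |: (X :\ x) \notin F].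
  have [/existsP[X /existsP[Y /existsP[x /and4P[? ? ? /forall_inP ?]]]]|noXYx] :=
    boolP [exists X, [exists Y, [exists x, [&& X \in F, Y \in F, x \in X :\: Y &
      [forall y in Y :\: X, y |: (X :\ x) \notin F]]]]]; first by exists X, Y, x.
  case: nmF; apply: basis_exchange_matroid => // A B x AF BF xAB.
  move: noXYx; rewrite negb_exists => /forallP/(_ A).
  rewrite negb_exists => /forallP/(_ B); rewrite negb_exists => /forallP/(_ x).
  rewrite AF BF xAB /= negb_forall => /existsP[y].
  by rewrite negb_imply negbK => /andP[yBA A'F]; exists y.
have [xX xY] : x \in X /\ x \notin Y by move: xXY; rewrite inE => /andP[].
pose P := [pred Z | [&& Z \in F, Z \subset X :|: Y & x \notin Z]].
have PY : P Y by rewrite /= YF subsetUr.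
have [Y' /and3P[Y'F Y'XY xY'] minY'] := @arg_minnP _ Y P (fun Z => #|Z :\: X|) PY.
have subY z : z \in Y' -> z \notin X -> z \in Y.
  by move=> zY' zX; have := subsetP Y'XY z zY'; rewrite inE (negPf zX).
have : Y' :\: X != set0.
  apply/negP=> /eqP/eqP; rewrite setD_eq0 => sY'X; have := acF _ _ Y'F XF.
  by rewrite properE sY'X => /negP []; apply/subsetPn; exists x.
case/set0Pn=> b bY'X.
have [bY' bX] : b \in Y' /\ b \notin X by move: bY'X; rewrite inE => /andP[].
have [/eqP c0 | [c cY'Xb]] := set_0Vmem (Y' :\: X :\ b); last first.
  have [cb cX cY'] : [/\ c != b, c \notin X & c \in Y'].
    by move: cY'Xb; rewrite !inE => /and3P[].
  exists X, Y', x, b, c; split=> //; first by rewrite inE xY'.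
    by split=> //; [rewrite inE cX | rewrite eq_sym].
  move=> Z ZF ZXY'; apply/orP; have [xZ|xZ] := boolP (x \in Z); [by left | right].
  have ZXY : Z \subset X :|: Y.
    by rewrite (subset_trans ZXY') // subUset subsetUl.
  have sZY' : Z :\: X \subset Y' :\: X.
    apply/subsetP=> z; rewrite !inE => /andP[zX zZ]; rewrite zX /=.
    by have := subsetP ZXY' z zZ; rewrite inE (negPf zX).
  (* A member inside [X :|: Y'] that avoids [x] competes in the choice of [Y'], so it has the same
     elements outside [X], among them [b] and [c]. *)
  have /eqP eZY' : Z :\: X == Y' :\: X.
    by rewrite eqEcard sZY' minY' //= ZF ZXY.
  move: bY'X; have : c \in Y' :\: X by rewrite inE cX.
  by rewrite -eZY' !inE => /andP[_ ->] /andP[_ ->].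
have Y'sub : Y' \subset b |: X.
  apply/subsetP=> z zY'; rewrite !inE; apply: contraT; rewrite negb_or => /andP[zb zX].
  by move/eqP/setP/(_ z): c0; rewrite !inE zb zX zY'.
(* Otherwise [Y'] would be [X] with [x] replaced by [b], which [noy] excludes. *)
have [c cXY' cx] : exists2 c, c \in X :\: Y' & x != c.
  apply/exists_inP; apply: contraT => /exists_inPn noc.
  have := noy b; rewrite inE bX (subY b) // => /(_ isT).
  suff -> : b |: X :\ x = Y' by rewrite Y'F.
  apply/setP=> z; rewrite !inE.
  have [-> | zb] /= := eqVneq z b; first by rewrite bY'.
  have [-> | zx] /= := eqVneq z x; first by rewrite (negPf xY').
  apply/idP/idP=> [zX | zY'].
    apply: contraT => zY'; have := noc z; rewrite inE zY' zX => /(_ isT).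
    by rewrite negbK eq_sym (negPf zx).
  by have := subsetP Y'sub z zY'; rewrite !inE (negPf zb).
have [cX cY'] : c \in X /\ c \notin Y' by move: cXY'; rewrite inE => /andP[].
exists Y', X, b, x, c; split=> //; first by split=> //; rewrite inE xY'.
move=> Z ZF ZY'X; have [// | bZ] := boolP (b \in Z).
(* A member of [Y' :|: X] that misses [b] lies in [X], hence equals [X]. *)
suff /eqP -> : Z == X by rewrite xX cX.
rewrite eqEproper acF // andbT; apply/subsetP=> z zZ.
have := subsetP ZY'X z zZ; rewrite inE => /orP[/(subsetP Y'sub) | //].
by rewrite !inE => /orP[/eqP zb | //]; rewrite -zb zZ in bZ.
Qed.

End NonMatroid.

(* Imported only here because the classical sets shadow notations and lemmas of
   finset. *)
From mathcomp Require Import all_classical all_reals all_analysis.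
From mathcomp Require Import ring lra zify.

Import Order.TTheory GRing.Theory Num.Theory.
Import numFieldNormedType.Exports.

Local Open Scope classical_set_scope.
Local Open Scope ring_scope.

(** * Quadratic costs and continuity of finite sums *)

Lemma quadratic_admissible (R : realType) (a b k : R) :
  0 <= a -> 0 <= b -> 0 < a + b -> 0 <= k ->
  admissible_cost (fun t => a * t ^+ 2 + b * t + k).
Proof.
move=> a0 b0 ab0 k0; split.
- by move=> x x0; rewrite !addr_ge0 // ?mulr_ge0 // exprn_ge0.
- move=> x y x0 xy; rewrite -subr_gt0.
  rewrite (_ : _ - _ = (y - x) * (a * (y + x) + b)); last by ring.
  rewrite mulr_gt0 ?subr_gt0 //.
  have yx0 : 0 < y + x by rewrite ltr_wpDr // (le_lt_trans x0).
  have [a_gt0|a_le0] := ltrP 0 a; first by rewrite ltr_wpDr // mulr_gt0.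
  by rewrite ltr_wpDl ?mulr_ge0 ?(ltW yx0) //; lra.
- move=> x x0; apply/cvg_ex; exists (a * (x + x) + b).
  (* Away from [x] the difference quotient equals [a * (y + x) + b]. *)
  have toid : (fun y => a * (y + x) + b) @ within [set y | 0 <= y] x^' -->
      (a * (x + x) + b).
    apply: cvg_within_filter; apply: cvg_within_filter.
    apply: cvgD; last exact: cvg_cst.
    by apply: cvgM; [exact: cvg_cst | apply: cvgD => //; exact: cvg_cst].
  apply: cvg_trans toid; apply: near_eq_cvg.
  rewrite near_withinE; near=> y => _.
  have yx : y != x by near: y; apply: nbhs_dnbhs_neq.
  by field; rewrite subr_eq0.
- move=> t x y; rewrite !inE /= => x0 y0.
  have s0 : 0 <= t%:num by exact: ge0.
  have s1 : t%:num <= 1 by exact: le1.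
  rewrite [conv t x y](convRE (R := R)) !convRE /unstable.onem -subr_ge0 /=.
  move: (t%:num) s0 s1 => s s0 s1.
  (* The affine terms cancel in the convexity gap; only the square contributes. *)
  rewrite [leRHS](_ : _ = a * (s * (1 - s)) * ((x : R) - y) ^+ 2).
    by rewrite mulr_ge0 ?sqr_ge0 // !mulr_ge0 // subr_ge0.
  by ring.
Unshelve. all: by end_near. Qed.

Lemma continuous_sumr (R : realType) (T : topologicalType) (I : finType) (P : pred I)
    (f : I -> T -> R) :
  (forall i, P i -> continuous (f i)) -> continuous (fun x => \sum_(i | P i) f i x).
Proof.
move=> cf; have addc : continuous (fun x : R * R => x.1 + x.2).
  by move=> x; apply: cvgD; [exact: cvg_fst | exact: cvg_snd].
exact: (continuous_big (x0 := 0) addc cf).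
Qed.

(** * Minima over a simplex *)

Section Minimum.
Variables (R : realType) (I : finType) (P : {set I}) (d : R).
Variable g : (I -> R) -> R.

(** The coordinates outside [P] are unconstrained, so the feasible set need not be compact. Since
    [g] ignores them, it suffices to minimise over the feasible points with all coordinates in
    [[0, d]], a closed part of a box that is compact by Tychonoff. *)
Lemma simplex_minimum : 0 <= d -> (P != finset.set0) ->
  (forall x y : I -> R, {in P, x =1 y} -> g x = g y) ->
  continuous (g : prod_topology (fun _ : I => R) -> R) ->
  exists2 x, (forall i, i \in P -> 0 <= x i) /\ \sum_(i in P) x i = d
    & forall y, (forall i, i \in P -> 0 <= y i) /\ \sum_(i in P) y i = d -> g x <= g y.
Proof.
move=> d0 P0 gP cg.
pose box := [set f : I -> R | forall i, [set` `[0, d]] (f i)].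
have cbox : @compact (prod_topology (fun _ : I => R)) box.
  by apply: (@tychonoff I (fun=> R) (fun=> [set` `[0, d]])) => i; exact: segment_compact.
pose tot (f : prod_topology (fun _ : I => R)) := \sum_(i in P) f i.
have cproj i : continuous (fun f : prod_topology (fun _ : I => R) => f i : R).
  exact: (@proj_continuous I (fun _ => R) i).
have ctot : continuous tot by apply: continuous_sumr => i _; exact: cproj.
pose K := (box `&` (tot @^-1` [set d])).
have cK : @compact (prod_topology (fun _ : I => R)) K.
  apply: compact_closedI => //; apply: preimage_closed; last exact: closed_eq.
  by move=> x _; exact: ctot.
have KE x : (forall i, i \in P -> 0 <= x i) /\ \sum_(i in P) x i = d ->
    exists2 y, K y & {in P, x =1 y}.
  move=> [x0 sx]; exists (fun i => if i \in P then x i else 0); last by move=> i ->.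
  split=> /=.
    move=> i /=; rewrite in_itv /=; case: ifPn => iP; last by rewrite lexx.
    rewrite x0 //= -sx (bigD1 i) //= lerDl sumr_ge0 // => j /andP[jP _].
    exact: x0.
  by rewrite /tot -sx; apply: eq_bigr => i ->.
have KP x : K x -> (forall i, i \in P -> 0 <= x i) /\ \sum_(i in P) x i = d.
  move=> [bx tx]; split=> // i _; have := bx i.
  by rewrite /= in_itv /= => /andP[].
have K0 : (K !=set0).
  have [i0 i0P] := finset.set0Pn _ P0.
  have [] := KE (fun i => if i == i0 then d else 0).
    split=> [i _|]; first by case: ifP.
    by rewrite (bigD1 i0) //= eqxx big1 ?addr0 // => j /andP[_ /negPf ->].
  by move=> y Ky _; exists y.
have [x xK xmin] := @compact_EVT_min (prod_topology (fun _ : I => R)) R g K K0 cK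
   (continuous_subspaceT cg).
exists x; first by apply: KP; exact: set_mem.
move=> y /KE[y' Ky' yy']; rewrite (gP _ _ yy'); apply: xmin; exact: mem_set.
Qed.

End Minimum.

(** * Best responses to fixed loads *)

Section BestResponse.
Variables (R : realType) (E : finType) (F : {set {set E}}).
Variables (c : E -> R -> R) (o : E -> R).
Implicit Types (y : {set E} -> R) (A P Z : {set E}).

Definition unit_strategy y : Prop :=
  (forall A, A \in F -> 0 <= y A) /\ \sum_(A in F) y A = 1.

Definition own_load y e : R := \sum_(A in F | e \in A) y A.

(** Here [o e] stands for the load of the other players on [e], held fixed. *)
Definition response_cost y : R := \sum_e c e (o e + own_load y e) * own_load y e.

Definition best_response y : Prop :=
  unit_strategy y /\ forall y', unit_strategy y' -> response_cost y <= response_cost y'.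

Lemma best_response_exists : F != finset.set0 -> (forall e, continuous (c e)) ->
  exists y, best_response y.
Proof.
move=> F0 cc.
have [||y ? ?] := @simplex_minimum R {set E} F 1 response_cost ler01 F0; last by exists y.
  move=> x y xy; apply: eq_bigr => e _.
  suff -> : own_load x e = own_load y e by [].
  by apply: eq_bigr => A /andP[AF _]; rewrite xy.
pose X := prod_topology (fun _ : {set E} => R).
have cl e : continuous (own_load^~ e : X -> R).
  by apply: continuous_sumr => A _; exact: (@proj_continuous {set E} (fun _ => R) A).
have cterm e : continuous (fun y : X => c e (o e + own_load y e) * own_load y e).
  have co : continuous (fun t => c e (o e + t) * t).
    move=> t; apply: cvgM; last exact: cvg_id.
    apply: (@cvg_comp _ _ _ (+%R (o e)) (c e)); last exact: cc.
    by apply: cvgD; [exact: cvg_cst | exact: cvg_id].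
  move=> y; apply: (@continuous_comp X R R (own_load^~ e) (fun t => c e (o e + t) * t));
    [exact: cl | exact: co].
exact: (@continuous_sumr R X E xpredT
  (fun e y => c e (o e + own_load y e) * own_load y e) (fun e _ => @cterm e)).
Qed.

Lemma own_load_ge0 y e : unit_strategy y -> 0 <= own_load y e.
Proof. by case=> y0 _; apply: sumr_ge0 => A /andP[AF _]; exact: y0. Qed.

Lemma own_load_le1 y e : unit_strategy y -> own_load y e <= 1.
Proof.
case=> y0 <-; rewrite [leRHS](bigID (fun A => e \in A)) /= lerDl.
by apply: sumr_ge0 => A /andP[AF _]; exact: y0.
Qed.

Lemma own_load_indic P e : P \in F -> own_load (fun A => (A == P)%:R) e = (e \in P)%:R.
Proof.
move=> PF; rewrite /own_load; have [eP | eP] := boolP (e \in P).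
  rewrite (bigD1 P) ?PF //= eqxx big1 ?addr0 // => A /andP[_ /negPf ->] //.
by rewrite big1 // => A /andP[_ eA]; case: eqP eA eP => // -> ->.
Qed.

(* Moving the whole mass of Z to P costs at most [D e] per unit on each resource
   of P :\: Z and saves at least [c e (o e)] per unit on each one of Z :\: P. *)
Lemma best_response_support y P Z (D : E -> R) : best_response y ->
  P \in F -> Z \in F ->
  (forall e, 0 <= o e) ->
  (forall e u v, 0 <= u -> u <= v -> 0 <= c e u <= c e v) ->
  (forall e l s, e \in P -> 0 <= l -> 0 <= s -> l + s <= 1 ->
     c e (o e + (l + s)) * (l + s) <= c e (o e + l) * l + s * D e) ->
  \sum_(e in P :\: Z) D e < \sum_(e in Z :\: P) c e (o e) ->
  y Z = 0.
Proof.
move=> [ys ymin] PF ZF o0 mono DP lt_DZ; have [y0 y1] := ys.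
have PZ : P != Z.
  by apply: contraTneq lt_DZ => ->; rewrite finset.setDv !big_set0 ltxx.
pose s := y Z; pose y' A := y A + s * ((A == P)%:R - (A == Z)%:R).
have s0 : 0 <= s by exact: y0.
have y's : unit_strategy y'.
  split=> [A AF | ]; rewrite /y'.
    have [-> | AZ] := eqVneq A Z; first by rewrite eq_sym (negPf PZ) sub0r mulrN1 subrr.
    by rewrite subr0 addr_ge0 ?y0 // mulr_ge0.
  rewrite big_split /= y1 -big_distrr /= sumrB.
  have one Q : Q \in F -> \sum_(A in F) (A == Q)%:R = 1 :> R.
    by move=> QF; rewrite (bigD1 Q) //= eqxx big1 ?addr0 // => A /andP[_ /negPf ->].
  by rewrite !one // subrr mulr0 addr0.
have ly' e : own_load y' e = own_load y e + s * ((e \in P)%:R - (e \in Z)%:R).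
  by rewrite -!own_load_indic // /own_load big_split /= -big_distrr /= sumrB.
apply/eqP; rewrite eq_le s0 andbT leNgt; apply/negP=> s_gt0.
have := ymin _ y's; rewrite leNgt => /negP; apply.
rewrite -subr_lt0 /response_cost -sumrB.
apply: (@le_lt_trans _ _
    (s * (\sum_(e in P :\: Z) D e - \sum_(e in Z :\: P) c e (o e)))); last first.
  by rewrite pmulr_rlt0 // subr_lt0.
rewrite [\sum_(e in P :\: Z) _]big_mkcond [\sum_(e in Z :\: P) _]big_mkcond.
rewrite -sumrB big_distrr /=.
apply: ler_sum => e _; rewrite !inE.
have l0 := own_load_ge0 e ys; have l'0 := own_load_ge0 e y's.
have l'1 := own_load_le1 e y's.
rewrite ly' in l'0 l'1 *; case: (boolP (e \in P)) l'0 l'1 => eP; case: (e \in Z) => /=.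
- by rewrite !subrr mulr0 addr0 subrr.
- by rewrite !subr0 mulr1 => _ l'1; rewrite lerBlDl DP.
(* On [Z :\: P] the saving is at least [s * c e (o e + l)], by monotonicity from [l - s] to [l], and
   this is at least [s * c e (o e)]. *)
- rewrite !sub0r mulrN1 => l'0 _.
  set l := own_load y e in l0 l'0 *.
  have /andP[_ le1] : 0 <= c e (o e + (l - s)) <= c e (o e + l).
    by apply: mono; [exact: addr_ge0 | lra].
  have /andP[_ le2] : 0 <= c e (o e) <= c e (o e + l) by apply: mono => //; lra.
  nra.
- by rewrite !subrr mulr0 addr0 subrr.
Qed.

End BestResponse.

(** * Equilibria with prescribed loads on shared resources *)

Section Equilibrium.
Variables (R : realType) (N E : finType) (F : N -> {set {set E}}).
Variable c : N -> E -> R -> R.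

Lemma player_cost_response x i :
  player_cost F c x i =
  response_cost (F i) (c i) (fun e => \sum_(j | j != i) load F x j e) (x i).
Proof.
apply: eq_bigr => e _; rewrite /own_load -/(load F x i e) /total_load.
by rewrite (bigD1 i) //= addrC.
Qed.

(** Let every player respond to the loads [o i] that the targets [P] would produce. The strict
    comparison removes all mass from sets that disagree with [P i] on a shared resource, so the
    shared loads are the targeted ones. Thus [o i] is the true load of the others wherever player
    [i] can go, and the responses form an equilibrium. *)
Lemma equilibrium_with_loads (P : N -> {set E}) (shared : pred E) (D : N -> E -> R) :
  let o i e := \sum_(j | j != i) (e \in P j)%:R in
  (forall i, P i \in F i) ->
  (forall i j A B e, i != j -> A \in F i -> B \in F j -> e \in A -> e \in B -> shared e) ->
  (forall i e, continuous (c i e)) ->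
  (forall i e u v, 0 <= u -> u <= v -> 0 <= c i e u <= c i e v) ->
  (forall i e l s, e \in P i -> 0 <= l -> 0 <= s -> l + s <= 1 ->
     c i e (o i e + (l + s)) * (l + s) <= c i e (o i e + l) * l + s * D i e) ->
  (forall i Z, Z \in F i -> (exists2 e, shared e & (e \in Z) != (e \in P i)) ->
     \sum_(e in P i :\: Z) D i e < \sum_(e in Z :\: P i) c i e (o i e)) ->
  exists x, nash_equilibrium F (fun=> 1) c x /\
    forall i e, shared e -> load F x i e = (e \in P i)%:R.
Proof.
move=> o PF disj cc mono DP bad.
have [x xbr] : {x & forall i, best_response (F i) (c i) (o i) (x i)}.
  apply: (@boolp.choice N _ (fun i y => best_response (F i) (c i) (o i) y)) => i.
  by apply: best_response_exists => //; apply/finset.set0Pn; exists (P i).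
have xl i e : shared e -> load F x i e = (e \in P i)%:R.
  move=> she; have [[_ x1] _] := xbr i.
  have x0 Z : Z \in F i -> (e \in Z) != (e \in P i) -> x i Z = 0.
    move=> ZF eZ; apply: (best_response_support (xbr i) (PF i) ZF _ (mono i) (DP i)).
      by move=> f; apply: sumr_ge0.
    by apply: bad => //; exists e.
  rewrite /load; have [eP | eP] := boolP (e \in P i).
    rewrite -[RHS]x1 [RHS](bigID (fun A : {set E} => e \in A)) /= [X in _ + X]big1 ?addr0 //.
    by move=> A /andP[AF /negPf eA]; apply: x0 => //; rewrite eA eP.
  by rewrite big1 // => A /andP[AF eA]; apply: x0 => //; rewrite eA (negPf eP).
exists x; split=> //; split=> [i | i yi yis]; first by case: (xbr i).
have toP z : (forall j, j != i -> z j = x j) ->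
    player_cost F c z i = response_cost (F i) (c i) (o i) (z i).
  move=> zx; rewrite player_cost_response; apply: eq_bigr => e _.
  (* Resources out of reach of [i] contribute zero on both sides; an unshared one within reach of
     [i] lies in no set of another player. *)
  have [[A AF eA] | noA] := pselect (exists2 A, A \in F i & e \in A); last first.
    suff -> : own_load (F i) (z i) e = 0 by rewrite !mulr0.
    by apply: big1 => A /andP[AF eA]; case: noA; exists A.
  suff -> : \sum_(j | j != i) load F z j e = o i e by [].
  apply: eq_bigr => j ji; rewrite /load zx // -/(load F x j e).
  have [she | nshe] := boolP (shared e); first exact: xl.
  have noB B : B \in F j -> e \in B -> False.
    by move=> BF eB; move: nshe; rewrite (disj j i B A).
  case: (boolP (e \in P j)) => [eP | _]; first by case: (noB (P j)).
  by apply: big1 => B /andP[BF eB]; case: (noB B).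
rewrite !toP //=; last by move=> j /negPf /= ->.
by rewrite eqxx; have [_] := xbr i; apply.
Qed.

End Equilibrium.

(** An injective self-map of a finite type is bijective, so [k] has exactly one preimage, and it is
    left out precisely when it is [i]. With [f] among [id], [s] and [s \o s] this counts the other
    users of [r k]. *)
Lemma sum_indic_neq (R : pzRingType) (N : finType) (f : N -> N) (i k : N) :
  injective f -> \sum_(j | j != i) (k == f j)%:R = (k != f i)%:R :> R.
Proof.
move=> finj; have [g fg gf] := injF_bij finj.
have [-> | kfi] := eqVneq k (f i).
  by rewrite big1 // => j /negPf ji; rewrite (inj_eq finj) eq_sym ji.
rewrite (bigD1 (g k)) /=; last by apply: contraNneq kfi => <-; rewrite gf.
rewrite gf eqxx big1 ?addr0 // => j /andP[_ jgk].
by rewrite (_ : (k == f j) = false) //; apply: contraNF jgk => /eqP ->; rewrite fg.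
Qed.

Lemma sum_indic_mem (R : pzRingType) (E : finType) (Q : {set E}) (a : E) :
  \sum_(e in Q) (e == a)%:R = (a \in Q)%:R :> R.
Proof.
have [aQ | aQ] := boolP (a \in Q).
  by rewrite (bigD1 a) //= eqxx big1 ?addr0 // => e /andP[_ /negPf ->].
by rewrite big1 // => e eQ; rewrite (_ : (e == a) = false) //; apply: contraNF aQ => /eqP <-.
Qed.

(** * The game and its two equilibria *)

Section SharedResources.
Variables (R : realType) (N E : finType) (F : N -> {set {set E}}).
Variables (r : N -> E) (s : N -> N) (A B : N -> {set E}).

(* Coefficients (a, b, k) of the cost a t^2 + b t + k.  The slope
   1 / (2 |E| + 1) keeps the total marginal cost of the cheap private resources
   below 1, the smaller slack of the two strict comparisons. *)
Definition cost_coefficients (i : N) (e : E) : R * R * R :=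
  if e \notin A i :|: B i then (0, 1, 28)
  else if e == r i then (7, 0, 0)
  else if e \in codom r then (0, 1, 10)
  else (0, (2 * #|E|%:R + 1)^-1, 0).

Definition game_cost (i : N) (e : E) (t : R) : R :=
  let: (a, b, k) := cost_coefficients i e in a * t ^+ 2 + b * t + k.

Lemma eps_gt0 : 0 < (2 * #|E|%:R + 1)^-1 :> R.
Proof. by rewrite invr_gt0 ltr_wpDl // mulr_ge0. Qed.

Lemma game_costP i e : exists a b k : R, [/\ 0 <= a, 0 <= b, 0 < a + b, 0 <= k
  & game_cost i e = fun t => a * t ^+ 2 + b * t + k].
Proof.
rewrite /game_cost /cost_coefficients; have e0 := eps_gt0.
case: ifP => _; first by exists 0, 1, 28; split=> //; rewrite add0r.
case: ifP => _; first by exists 7, 0, 0; split=> //; rewrite addr0.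
case: ifP => _; first by exists 0, 1, 10; split=> //; rewrite add0r.
by exists 0, (2 * #|E|%:R + 1)^-1, 0; split=> //; rewrite ?add0r // ltW.
Qed.

Lemma game_cost_admissible i e : admissible_cost (game_cost i e).
Proof. by have [a [b [k [? ? ? ? ->]]]] := game_costP i e; exact: quadratic_admissible. Qed.

Lemma game_cost_continuous i e : continuous (game_cost i e).
Proof.
have [a [b [k [_ _ _ _ ->]]]] := game_costP i e => x.
apply: cvgD; last exact: cvg_cst.
apply: cvgD; apply: cvgM; try exact: cvg_cst; first exact: exprn_continuous.
exact: cvg_id.
Qed.

Lemma game_cost_mono i e u v : 0 <= u -> u <= v -> 0 <= game_cost i e u <= game_cost i e v.
Proof.
have [a [b [k [a0 b0 _ k0 ->]]]] := game_costP i e => u0 uv.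
apply/andP; split; first by rewrite !addr_ge0 // mulr_ge0 // exprn_ge0.
by rewrite lerD2r lerD // ler_wpM2l // lerXn2r // nnegrE (le_trans u0).
Qed.

Lemma game_cost_ge0 i e u : 0 <= u -> 0 <= game_cost i e u.
Proof. by move=> u0; have /andP[] := game_cost_mono i e u0 (lexx u). Qed.

Hypothesis r_inj : injective r.
Hypothesis s_inj : injective s.
Hypothesis s1 : forall i, s i != i.
Hypothesis s2 : forall i, s (s i) != i.
Hypothesis AF : forall i, A i \in F i.
Hypothesis BF : forall i, B i \in F i.
Hypothesis rA : forall i k, (r k \in A i) = (k == i).
Hypothesis rB : forall i k, (r k \in B i) = (k == s i) || (k == s (s i)).
Hypothesis dichotomy : forall i Z, Z \in F i -> Z \subset A i :|: B i ->
  (r i \in Z) || (r (s i) \in Z) && (r (s (s i)) \in Z).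
Hypothesis private : forall i j (Z W : {set E}) e, i != j -> Z \in F i -> W \in F j ->
  e \in Z -> e \in W -> e \in codom r.

Lemma game_cost_out i e t : e \notin A i :|: B i -> game_cost i e t = 28 + t.
Proof. by rewrite /game_cost /cost_coefficients => ->; ring. Qed.

Lemma game_cost_own i t : game_cost i (r i) t = 7 * t ^+ 2.
Proof. by rewrite /game_cost /cost_coefficients finset.inE rA !eqxx /=; ring. Qed.

Lemma game_cost_next i k t : (k == s i) || (k == s (s i)) ->
  game_cost i (r k) t = 10 + t.
Proof.
move=> ki; rewrite /game_cost /cost_coefficients finset.inE rB ki orbT /= (inj_eq r_inj).
rewrite codom_f (_ : (k == i) = false) /=; first by ring.
by apply/eqP=> ik; move: ki; rewrite ik ![i == _]eq_sym (negPf (s1 i)) (negPf (s2 i)).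
Qed.

Lemma game_cost_private i e t : e \in A i :|: B i -> e \notin codom r ->
  game_cost i e t = (2 * #|E|%:R + 1)^-1 * t.
Proof.
move=> eAB er; rewrite /game_cost /cost_coefficients eAB (negPf er).
by case: eqP er => [-> | _ _]; [rewrite codom_f | rewrite /=; ring].
Qed.

Let eps : R := (2 * #|E|%:R + 1)^-1.

Lemma sum_eps_lt1 (Q : {set E}) : \sum_(e in Q) 2 * eps < 1.
Proof.
rewrite sumr_const -mulr_natl.
have le : #|Q|%:R <= #|E|%:R :> R by rewrite ler_nat max_card.
have e0 : 0 < eps by exact: eps_gt0.
have : eps * (2 * #|E|%:R + 1) = 1 by rewrite mulVf // gt_eqF // ltr_wpDl // mulr_ge0.
nra.
Qed.

Lemma other_load_private (P : N -> {set E}) i e : (forall j, P j \in F j) ->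
  e \in P i -> e \notin codom r -> \sum_(j | j != i) (e \in P j)%:R = 0 :> R.
Proof.
move=> PF eP er; apply: big1 => j ji; case: (boolP (e \in P j)) => // ePj.
by move: er; rewrite (private ji (PF j) (PF i) ePj eP).
Qed.

Lemma other_load_A i k : \sum_(j | j != i) (r k \in A j)%:R = (k != i)%:R :> R.
Proof. by rewrite -(@sum_indic_neq R N id) //; apply: eq_bigr => j _; rewrite rA. Qed.

Lemma other_load_B i k :
  \sum_(j | j != i) (r k \in B j)%:R = (k != s i)%:R + (k != s (s i))%:R :> R.
Proof.
rewrite -(@sum_indic_neq R N s) // -(@sum_indic_neq R N (s \o s)); last exact: inj_comp.
rewrite -big_split; apply: eq_bigr => j _; rewrite rB /=.
(* The two alternatives of [rB] exclude each other because [s] has no fixed point, so the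
   disjunction is a sum. *)
have [-> | _] := eqVneq k (s j); last by rewrite add0r.
by rewrite (inj_eq s_inj) eq_sym (negPf (s1 j)) addr0.
Qed.

Lemma sum_ge_term (Q : {set E}) (f : E -> R) a :
  (forall e, 0 <= f e) -> a \in Q -> f a <= \sum_(e in Q) f e.
Proof. by move=> f0 aQ; rewrite (bigD1 a) //= lerDl sumr_ge0. Qed.

Lemma sum_ge_two_terms (Q : {set E}) (f : E -> R) a b :
  (forall e, 0 <= f e) -> a \in Q -> b \in Q -> a != b -> f a + f b <= \sum_(e in Q) f e.
Proof.
move=> f0 aQ bQ ab; rewrite (bigD1 a) //= lerD2l (bigD1 b) /= ?lerDl ?sumr_ge0 //.
by rewrite bQ eq_sym.
Qed.

(** A player alone on such a resource pays [eps * t ^+ 2], whose derivative on the unit interval is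
    at most [2 * eps]. *)
Lemma private_marginal i e l t : e \in A i :|: B i -> e \notin codom r ->
  0 <= l -> 0 <= t -> l + t <= 1 ->
  game_cost i e (0 + (l + t)) * (l + t) <= game_cost i e (0 + l) * l + t * (2 * eps).
Proof.
move=> eAB er l0 t0 lt1; rewrite !game_cost_private // -/eps.
have e0 : 0 < eps by exact: eps_gt0.
rewrite -subr_ge0 (_ : _ - _ = eps * (t * (2 - (l + t) - l))); last by ring.
by rewrite mulr_ge0 ?(ltW e0) // mulr_ge0 //; lra.
Qed.

Lemma s_neq i : r (s i) != r (s (s i)).
Proof. by rewrite (inj_eq r_inj) (inj_eq s_inj) eq_sym s1. Qed.

Lemma equilibrium_A : exists x, nash_equilibrium F (fun=> 1) game_cost x /\
  forall i e, e \in codom r -> load F x i e = (e \in A i)%:R.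
Proof.
(* The constant 21 is the derivative at 1 of [7 * t ^+ 3], the cost to [i] of using [r i] alone. *)
apply: (@equilibrium_with_loads R N E F game_cost A (mem (codom r))
  (fun i e => 21 * (e == r i)%:R + 2 * eps)) => //.
- exact: game_cost_continuous.
- exact: game_cost_mono.
- move=> i e l t eA l0 t0 lt1.
  have eAB : e \in A i :|: B i by rewrite finset.inE eA.
  have [/codomP[k ek] | er] := boolP (e \in codom r).
    move: eA; rewrite {}ek {e eAB} rA => /eqP ->.
    rewrite other_load_A eqxx !game_cost_own eqxx !add0r mulr1 /=.
    have e0 : 0 < eps by exact: eps_gt0.
    (* Factoring the difference of cubes leaves three products, each at most 1. *)
    rewrite -subr_ge0 (_ : _ - _ = t * (7 * (3 - (l + t) ^+ 2 - l * (l + t) - l ^+ 2)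
      + 2 * eps)); last by ring.
    have l1 : l <= 1 by lra.
    have lt0 := addr_ge0 l0 t0.
    have le1 := mulr_ile1 l0 lt0 l1 lt1; have le2 := exprn_ile1 2 l0 l1.
    by have le3 := exprn_ile1 2 lt0 lt1; rewrite mulr_ge0 //; lra.
  rewrite (other_load_private AF eA er) (le_trans (private_marginal eAB er l0 t0 lt1)) //.
  by rewrite lerD2l ler_wpM2l // lerDr mulr_ge0.
move=> i Z ZF [_ /codomP[k ->]]; rewrite rA => Zk.
rewrite big_split /= -big_distrr /= sum_indic_mem.
have := sum_eps_lt1 (A i :\: Z); set T := \sum_(e in _) 2 * eps => T1.
pose f e := game_cost i e (\sum_(j | j != i) (e \in A j)%:R).
rewrite [ltRHS](_ : _ = \sum_(e in Z :\: A i) f e) //.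
have f0 e : 0 <= f e by apply: game_cost_ge0; apply: sumr_ge0.
have D21 : 21 * (r i \in A i :\: Z)%:R <= 21 :> R by rewrite ler_piMr // lern1 leq_b1.
have fnext m : (m == s i) || (m == s (s i)) -> f (r m) = 11.
  move=> mi; rewrite /f game_cost_next // other_load_A.
  suff -> : m != i by rewrite mulr1n; lra.
  by apply: contraTneq mi => ->; rewrite ![i == _]eq_sym (negPf (s1 i)) (negPf (s2 i)).
(* Either [Z] leaves [A i :|: B i] and pays at least 28 against at most [21 + T]; or it contains
   [r i] and another shared resource, paying 11 against [T]; or it misses [r i] and pays 11 twice
   against at most [21 + T]. Always [T < 1]. *)
have [ZAB | /fintype.subsetPn[e eZ eAB]] := boolP (Z \subset A i :|: B i); last first.
  have eZA : e \in Z :\: A i.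
    by rewrite finset.inE eZ andbT; apply: contra eAB => eA; rewrite finset.inE eA.
  have := sum_ge_term f0 eZA; rewrite {1}/f game_cost_out //.
  have : 0 <= \sum_(j | j != i) (e \in A j)%:R :> R by apply: sumr_ge0.
  lra.
have [riZ | riZ] := boolP (r i \in Z).
  have ki : k != i by apply: contraNneq Zk => ->; rewrite riZ eqxx.
  have rkZ : r k \in Z by move: Zk; rewrite (negPf ki); case: (_ \in _).
  have rkZA : r k \in Z :\: A i by rewrite finset.inE rkZ rA ki.
  have := sum_ge_term f0 rkZA; rewrite fnext; last first.
    by have := fintype.subsetP ZAB _ rkZ; rewrite finset.inE rA (negPf ki) rB.
  rewrite finset.inE riZ /=; lra.
have := dichotomy ZF ZAB; rewrite (negPf riZ) /= => /andP[bZ cZ].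
have bZA : r (s i) \in Z :\: A i by rewrite finset.inE bZ rA s1.
have cZA : r (s (s i)) \in Z :\: A i by rewrite finset.inE cZ rA s2.
have := sum_ge_two_terms f0 bZA cZA (s_neq i).
by rewrite !fnext ?eqxx ?orbT //; lra.
Qed.

Lemma equilibrium_B : exists x, nash_equilibrium F (fun=> 1) game_cost x /\
  forall i e, e \in codom r -> load F x i e = (e \in B i)%:R.
Proof.
(* The constant 13 is the derivative at 1 of [(11 + t) * t], as each of the two resources has
   exactly one other user. *)
apply: (@equilibrium_with_loads R N E F game_cost B (mem (codom r))
  (fun i e => 13 * (e == r (s i))%:R + 13 * (e == r (s (s i)))%:R + 2 * eps)) => //.
- exact: game_cost_continuous.
- exact: game_cost_mono.
- move=> i e l t eB l0 t0 lt1.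
  have e0 : 0 < eps by exact: eps_gt0.
  have eAB : e \in A i :|: B i by rewrite finset.inE eB orbT.
  have [/codomP[k ek] | er] := boolP (e \in codom r).
    move: eB; rewrite {}ek {e eAB} rB => ki.
    rewrite other_load_B !game_cost_next // !(inj_eq r_inj).
    case/orP: ki => /eqP ->; rewrite eqxx (inj_eq s_inj).
      by rewrite [i == _]eq_sym (negPf (s1 i)) /=; nra.
    by rewrite (negPf (s1 i)) /=; nra.
  rewrite (other_load_private BF eB er) (le_trans (private_marginal eAB er l0 t0 lt1)) //.
  by rewrite lerD2l ler_wpM2l // lerDr addr_ge0 // mulr_ge0.
move=> i Z ZF [_ /codomP[k ->]]; rewrite rB => Zk.
rewrite !big_split /=.
have := sum_eps_lt1 (B i :\: Z); set T := \sum_(e in _) 2 * eps => T1.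
rewrite -!big_distrr /= !sum_indic_mem.
pose f e := game_cost i e (\sum_(j | j != i) (e \in B j)%:R).
rewrite [ltRHS](_ : _ = \sum_(e in Z :\: B i) f e) //.
have f0 e : 0 <= f e by apply: game_cost_ge0; apply: sumr_ge0.
have D13 e : 13 * (e \in B i :\: Z)%:R <= 13 :> R by rewrite ler_piMr // lern1 leq_b1.
have D1 := D13 (r (s i)); have D2 := D13 (r (s (s i))).
(* The amount to beat is at most [26 + T]. Leaving [A i :|: B i] costs at least 28, and so does
   [r i], whose two other users make its cost [7 * 2 ^+ 2]. *)
have [ZAB | /fintype.subsetPn[e eZ eAB]] := boolP (Z \subset A i :|: B i); last first.
  have eZB : e \in Z :\: B i.
    by rewrite finset.inE eZ andbT; apply: contra eAB => eB; rewrite finset.inE eB orbT.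
  have := sum_ge_term f0 eZB; rewrite {1}/f game_cost_out //.
  have : 0 <= \sum_(j | j != i) (e \in B j)%:R :> R by apply: sumr_ge0.
  lra.
have iB : r i \notin B i by rewrite rB ![i == _]eq_sym negb_or s1 s2.
have [riZ | riZ] := boolP (r i \in Z).
  have riZB : r i \in Z :\: B i by rewrite finset.inE iB riZ.
  have := sum_ge_term f0 riZB; rewrite {1}/f game_cost_own other_load_B.
  by rewrite ![i == _]eq_sym s1 s2 /=; lra.
(* Without [r i], the set contains both other shared resources, so it agrees with [B i] on all
   shared ones, contrary to the choice of [k]. *)
have := dichotomy ZF ZAB; rewrite (negPf riZ) /= => /andP[bZ cZ].
have [ki | ki] := boolP ((k == s i) || (k == s (s i))).
  by move: Zk; rewrite ki; case/orP: ki => /eqP ->; rewrite ?bZ ?cZ.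
have rkZ : r k \in Z by move: Zk; rewrite (negPf ki); case: (_ \in _).
have := fintype.subsetP ZAB _ rkZ; rewrite finset.inE rA rB (negPf ki) orbF => /eqP ik.
by rewrite -ik rkZ in riZ.
Qed.

Lemma game_not_unique : (0 < #|N|)%N -> ~ unique_equilibria F (fun=> 1) game_cost.
Proof.
move=> /card_gt0P[i _] uniq; have [x [xN xl]] := equilibrium_A; have [y [yN yl]] := equilibrium_B.
have := uniq x y xN yN i (r i).
rewrite xl ?codom_f // yl ?codom_f // rA rB eqxx ![i == _]eq_sym.
by rewrite (negPf (s1 i)) (negPf (s2 i)) => /eqP; rewrite oner_eq0.
Qed.

End SharedResources.

(* Cyclic shifts and the embedding *)
Local Close Scope ring_scope.
Local Close Scope classical_set_scope.

(** Neither 1 nor 2 vanishes modulo [n]. The pair serves as one rewriting rule for both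
    inequalities. *)
Lemma ordS_neq n (k : 'I_n) : 3 <= n -> (ordS k != k) * (ordS (ordS k) != k).
Proof.
have modS m : m < n -> m.+1 %% n = if m.+1 == n then 0 else m.+1.
  by case: eqP => [-> | ne lt]; rewrite ?modnn // modn_small //; lia.
move=> n3; have kn := ltn_ord k.
split; rewrite -val_eqE /= (modS k) //; first by case: ifP; lia.
by case: ifP => ?; rewrite modS; try case: ifP; lia.
Qed.

(** The successor modulo [#|N|] is transported along the enumeration of [N]; three players are what
    keeps [s (s i)] away from [i]. *)
Lemma exists_cyclic_shift (N : finType) : 3 <= #|N| ->
  exists s : N -> N, [/\ injective s, forall i, s i != i & forall i, s (s i) != i].
Proof.
move=> N3; exists (fun i => enum_val (ordS (enum_rank i))); split=> [i j | i | i].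
- by move=> /enum_val_inj /ordS_inj /enum_rank_inj.
- by rewrite -(inj_eq enum_rank_inj) enum_valK ordS_neq.
- by rewrite -(inj_eq enum_rank_inj) !enum_valK ordS_neq.
Qed.

(** Embeddings live on the subtype of the ground set; this passes to plain images under a map on the
    whole type, since elements of a member lift to the subtype. *)
Lemma embedded_set_imset (T E : finType) (F : {set {set T}}) (f : T -> E) (Z : {set T}) :
  Z \in F ->
  embedded_set (fun e : {e : T | e \in ground_set F} => f (val e)) Z = f @: Z.
Proof.
move=> ZF; apply/setP=> e; apply/imsetP/imsetP => [[u uZ ->] | [u uZ ->]].
  by exists (val u) => //; move: uZ; rewrite inE.
have uF : u \in ground_set F by apply/bigcupP; exists Z.
by exists (exist _ u uF); rewrite ?inE.
Qed.

Section Sharing.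
Variables (N : finType) (T : N -> finType) (s : N -> N) (i : N) (a b c : T i).
Hypotheses (s_inj : injective s) (s1 : forall j, s j != j) (s2 : forall j, s (s j) != j).
Hypotheses (ab : a != b) (ac : a != c) (bc : b != c).

(** The element [inr k] is the shared resource [r k]. The tag of an [inl] element records its owner,
    so private copies of different players never meet. *)
Definition share (e : T i) : {j : N & T j} + N :=
  if e == a then inr i else if e == b then inr (s i)
  else if e == c then inr (s (s i)) else inl (Tagged T e).

Lemma share_inj : injective share.
Proof.
have si : s (s i) != s i by rewrite (inj_eq s_inj).
move=> u v; rewrite /share.
case: (u =P a) => [-> | _]; [| case: (u =P b) => [-> | _]; [| case: (u =P c) => [-> | _]]];
  (case: (v =P a) => [-> | _]; [| case: (v =P b) => [-> | _];
     [| case: (v =P c) => [-> | _]]]) => //.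
- by case=> /eqP; rewrite eq_sym (negPf (s1 i)).
- by case=> /eqP; rewrite eq_sym (negPf (s2 i)).
- by case=> /eqP; rewrite (negPf (s1 i)).
- by case=> /eqP; rewrite eq_sym (negPf si).
- by case=> /eqP; rewrite (negPf (s2 i)).
- by case=> /eqP; rewrite (negPf si).
- by case=> /eqP; rewrite eq_Tagged => /eqP.
Qed.

Lemma mem_share_inr (Z : {set T i}) (k : N) : (inr k \in share @: Z) =
  [|| (k == i) && (a \in Z), (k == s i) && (b \in Z) | (k == s (s i)) && (c \in Z)].
Proof.
apply/imsetP/idP => [[u uZ] | ].
  rewrite /share; case: (u =P a) => [<- [->] | _]; first by rewrite eqxx uZ.
  case: (u =P b) => [<- [->] | _]; first by rewrite eqxx uZ orbT.
  by case: (u =P c) => [<- [->] | _ //]; rewrite eqxx uZ !orbT.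
case/or3P=> /andP[/eqP -> uZ]; [exists a | exists b | exists c] => //; rewrite /share.
- by rewrite eqxx.
- by rewrite eq_sym (negPf ab) eqxx.
- by rewrite ![c == _]eq_sym (negPf ac) (negPf bc) eqxx.
Qed.

Lemma mem_share_inl (Z : {set T i}) p : inl p \in share @: Z -> tag p = i.
Proof.
case/imsetP=> u _; rewrite /share.
by case: ifP => // _; case: ifP => // _; case: ifP => // _ [->].
Qed.

End Sharing.

(** * Assembling the game from the triples *)

Theorem theorem7p4 (R : realType) (N : finType) (T : N -> finType)
    (S : forall i : N, {set {set T i}}) :
  3 <= #|N| ->
  (forall i : N, non_matroid (S i)) ->
  ~ strong_uniqueness R S.
Proof.
move=> N3 nmS uniqS; have [s [s_inj s1 s2]] := exists_cyclic_shift N3.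
have w i : {w : {set T i} * {set T i} * (T i * T i * T i) |
    non_matroid_triple (S i) w.1.1 w.1.2 w.2.1.1 w.2.1.2 w.2.2}.
  apply: cid; have [X [Y [a [b [c XYabc]]]]] := non_matroid_has_triple (nmS i).
  by exists (X, Y, (a, b, c)).
pose X i := (sval (w i)).1.1; pose Y i := (sval (w i)).1.2.
pose a i := (sval (w i)).2.1.1; pose b i := (sval (w i)).2.1.2; pose c i := (sval (w i)).2.2.
have wP i : non_matroid_triple (S i) (X i) (Y i) (a i) (b i) (c i) := svalP (w i).
pose f i := share s (a i) (b i) (c i).
have ab i : a i != b i.
  have [_ _ + [+ _ _] _] := wP i; rewrite !inE => /andP[_ aX] /andP[bX _].
  by apply: contraTneq aX => ->.
have ac i : a i != c i.
  have [_ _ + [_ + _] _] := wP i; rewrite !inE => /andP[_ aX] /andP[cX _].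
  by apply: contraTneq aX => ->.
have bc i : b i != c i by have [_ _ _ [_ _]] := wP i.
have f_inj i : injective (f i) by apply: share_inj.
pose r : N -> {j : N & T j} + N := inr.
have r_inj : injective r by move=> j k [].
pose tau i (e : {e : T i | e \in ground_set (S i)}) := f i (val e).
have FE i Z : reflect (exists2 Z0, Z0 \in S i & Z = f i @: Z0)
    (Z \in embedded_system (@tau i)).
  apply: (iffP imsetP) => [] [Z0 Z0S ->]; exists Z0 => //;
    by rewrite (embedded_set_imset (f i)).
have tau_inj i : injective (@tau i) by move=> u v /f_inj /val_inj.
apply: (@game_not_unique R N _ (fun i => embedded_system (@tau i)) r s
  (fun i => f i @: X i) (fun i => f i @: Y i)) => //.
- by move=> i; apply/FE; exists (X i) => //; have [] := wP i.
- by move=> i; apply/FE; exists (Y i) => //; have [] := wP i.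
- move=> i k; rewrite mem_share_inr //.
  have [_ _ + [+ + _] _] := wP i.
  rewrite !inE => /andP[_ ->] /andP[/negPf -> _] /andP[/negPf -> _].
  by rewrite !andbF andbT !orbF.
- move=> i k; rewrite mem_share_inr //.
  have [_ _ + [+ + _] _] := wP i.
  by rewrite !inE => /andP[/negPf -> _] /andP[_ ->] /andP[_ ->]; rewrite andbF !andbT.
- move=> i Z /FE[Z0 Z0S ->]; rewrite -imsetU => /fintype.subsetP ZXY.
  rewrite !mem_share_inr // !eqxx /= ![i == _]eq_sym (inj_eq s_inj).
  have [_ _ _ _ /(_ Z0 Z0S)] := wP i.
  (* Injectivity of [f i] pulls the inclusion of images back to [T i]. *)
  have -> : Z0 \subset X i :|: Y i.
    apply/fintype.subsetP => u uZ0; rewrite -(mem_imset _ _ (@f_inj i)).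
    by apply: ZXY; apply: imset_f.
  by move=> /(_ isT) /orP[-> // | /andP[-> ->]]; rewrite !orbT.
(* Every [inr] element is shared, and a common [inl] element would have both [i] and [j] as its
   tag. *)
- move=> i j Z W [p | k] ij /FE[Z0 _ ->] /FE[W0 _ ->]; last by move=> _ _; apply: codom_f.
  by move=> /mem_share_inl pi /mem_share_inl pj; rewrite -pi -pj eqxx in ij.
- exact: leq_trans N3.
by apply: uniqS => // i e; apply: game_cost_admissible.
Qed.
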